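(* Let $(X,D,P)$ be a complete perturbed metric space with exact metric $d=D-P$, and let $M\ge 1$ be a constant such that $D(x,y)\le M\,d(x,y)$ for all $x,y\in X$. Let $T:X\to X$ and $a,b,c\ge 0$ satisfy $$D(Tx,Ty)\le a\,D(x,y)+b\,D(x,Tx)+c\,D(y,Ty),\qquad x,y\in X,$$ and $M(a+b+c)<1$. Then $T$ has a unique fixed point, and for every $x_0\in X$ the Picard iteration $x_{n+1}=Tx_n$ converges to it in $(X,d)$.
   Context: A perturbed metric space $(X,D,P)$ consists of a nonempty set $X$ and two functions $D,P:X\times X\to[0,\infty)$ such that $d(x,y):=D(x,y)-P(x,y)$ is a metric on $X$, called the exact metric. Neither $D$ nor $P$ is assumed symmetric. $(X,D,P)$ is called complete if the metric space $(X,d)$ is complete. *)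

(* Defs.v *)
From HB Require Import structures.
From mathcomp Require Import all_boot all_order all_algebra.
From mathcomp Require Import boolp classical_sets filter reals topology.

Set Implicit Arguments.
Unset Strict Implicit.
Unset Printing Implicit Defensive.

Import Order.TTheory GRing.Theory Num.Theory.

Local Open Scope classical_set_scope.
Local Open Scope ring_scope.

Record is_metric (R : realType) (X : Type) (d : X -> X -> R) : Prop := IsMetric {
  is_metric_ge0 : forall x y, 0 <= d x y ;
  is_metric_eq0 : forall x y, d x y = 0 <-> x = y ;
  is_metric_sym : forall x y, d x y = d y x ;
  is_metric_triangle : forall x y z, d x z <= d x y + d y z
}.

(* A pointed type is the library's notion of a nonempty set. *)
Record perturbed_metric (R : realType) (X : pointedType) := PerturbedMetric {
  pdist : X -> X -> R ;
  perturbation : X -> X -> R ;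
  pdist_ge0 : forall x y, 0 <= pdist x y ;
  perturbation_ge0 : forall x y, 0 <= perturbation x y ;
  exact_is_metric : is_metric (fun x y => pdist x y - perturbation x y)
}.

Definition exact_dist (R : realType) (X : pointedType)
  (p : perturbed_metric R X) (x y : X) : R := pdist p x y - perturbation p x y.

(* An alias of X that carries the metric structure (hence the topology and the
   uniformity) of the exact metric: X itself has no canonical topology. *)
Definition exact_space (R : realType) (X : pointedType)
  (p : perturbed_metric R X) : Type := X.

Section ExactSpace.
Variables (R : realType) (X : pointedType) (p : perturbed_metric R X).
Local Notation exact_dist := (exact_dist p).
Local Notation exact_space := (exact_space p).

Let exact_dist_metric : is_metric exact_dist := exact_is_metric p.

Let exact_distxx (x : X) : exact_dist x x = 0.
Proof. by apply/(is_metric_eq0 exact_dist_metric). Qed.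

Let exact_dist_positivity (x y : X) : exact_dist x y = 0 -> x = y.
Proof. by move/(is_metric_eq0 exact_dist_metric). Qed.

Let exact_dist_triangle (y x z : X) :
  exact_dist x z <= exact_dist x y + exact_dist y z.
Proof. exact: (is_metric_triangle exact_dist_metric). Qed.

HB.instance Definition _ := Pointed.copy exact_space X.

HB.instance Definition _ := @isMetric.Build R exact_space exact_dist
  exact_distxx exact_dist_positivity (is_metric_sym exact_dist_metric)
  exact_dist_triangle.

End ExactSpace.

Definition perturbed_complete (R : realType) (X : pointedType)
    (p : perturbed_metric R X) : Prop :=
  forall u : nat -> exact_space p, cauchy (u @ \oo) -> cvg (u @ \oo).

(* Main.v *)
(* Since M >= 1, the bounds d <= D <= M d turn the hypothesis into a Reich
   contraction for the exact metric d, with constants M a, M b, M c of sum < 1.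
   For such a map the displacement d(x, f x) controls all distances:
   (1 - a) d(x, y) <= (1 + b) d(x, f x) + (1 + c) d(y, f y).
   The displacement decays geometrically along every orbit, so this single
   inequality gives Cauchyness of orbits, uniqueness of the fixed point, and
   convergence of every orbit to it. *)
Require Import Defs.
From mathcomp Require Import all_boot all_order all_algebra.
From mathcomp Require Import boolp classical_sets filter reals topology.
From mathcomp Require Import normedtype sequences ring lra.

Set Implicit Arguments.
Unset Strict Implicit.
Unset Printing Implicit Defensive.

Import Order.TTheory GRing.Theory Num.Theory.
Import numFieldNormedType.Exports.

Local Open Scope classical_set_scope.
Local Open Scope ring_scope.

Lemma near_geometric_lt (R : realType) (A z e : R) :
  0 <= z -> z < 1 -> 0 < e -> \forall n \near \oo, A * z ^+ n < e.
Proof.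
move=> z_ge0 z_lt1 e_gt0.
have cvg0 : geometric A z @ \oo --> 0.
  by apply: cvg_geometric; rewrite ger0_norm.
exact: (cvgr_lt 0 cvg0).
Qed.

Section ReichContraction.
Context (R : realType) (X : metricType R) (f : X -> X) (a b c : R).
Context (a_ge0 : 0 <= a) (b_ge0 : 0 <= b) (c_ge0 : 0 <= c).
Context (abc_lt1 : a + b + c < 1).
Context (f_reich : forall x y, mdist (f x) (f y) <=
  a * mdist x y + b * mdist x (f x) + c * mdist y (f y)).

Let a_lt1 : a < 1. Proof. by move: b_ge0 c_ge0 abc_lt1; lra. Qed.
Let b_le1 : b <= 1. Proof. by move: a_ge0 c_ge0 abc_lt1; lra. Qed.
Let c_lt1 : c < 1. Proof. by move: a_ge0 b_ge0 abc_lt1; lra. Qed.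

Let rate_ge0 : 0 <= (a + b) / (1 - c).
Proof. by rewrite divr_ge0 ?subr_ge0 ?addr_ge0 ?(ltW c_lt1). Qed.

Let rate_lt1 : (a + b) / (1 - c) < 1.
Proof. by rewrite ltr_pdivrMr ?subr_gt0// mul1r ltrBrDr. Qed.

(** Go from [x] to [y] through [f x] and [f y], bound the middle leg by the contraction, and absorb
    the resulting [a * mdist x y] on the left, as [a < 1]. *)
Lemma reich_mdist_le x y : mdist x y <=
  ((1 + b) * mdist x (f x) + (1 + c) * mdist y (f y)) / (1 - a).
Proof.
rewrite ler_pdivlMr; last by rewrite subr_gt0.
have tri1 := metric_triangle x (f x) y.
have tri2 := metric_triangle (f x) (f y) y.
have fxy := f_reich x y.
by rewrite (metric_sym (f y)) in tri2; lra.
Qed.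

(** The contraction at the pair [x], [f x] has the new displacement on its right with factor
    [c < 1]; absorbing it gives the rate. *)
Lemma reich_displacement_step x :
  mdist (f x) (f (f x)) <= (a + b) / (1 - c) * mdist x (f x).
Proof.
rewrite mulrAC ler_pdivlMr; last by rewrite subr_gt0.
by have := f_reich x (f x); lra.
Qed.

Lemma reich_displacement_iter n x : mdist (iter n f x) (f (iter n f x)) <=
  mdist x (f x) * ((a + b) / (1 - c)) ^+ n.
Proof.
elim: n => [|n IHn]; first by rewrite expr0 mulr1.
rewrite iterS (le_trans (reich_displacement_step _))// exprS mulrCA.
by rewrite ler_wpM2l.
Qed.

Lemma reich_displacement_near x e : 0 < e ->
  \forall n \near \oo, mdist (iter n f x) (f (iter n f x)) < e.
Proof.
move=> e_gt0.
apply: filterS (near_geometric_lt (mdist x (f x)) rate_ge0 rate_lt1 e_gt0) => n.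
exact/le_lt_trans/reich_displacement_iter.
Qed.

Lemma reich_iter_cauchy x : cauchy ((fun n => iter n f x) @ \oo).
Proof.
apply/cauchy_ballP => e e_gt0; rewrite near_map2.
(* Since [2 + b + c = (1 + b) + (1 + c)], displacements below [e * (1 - a) / (2 + b + c)] make the
   bound of [reich_mdist_le] smaller than [e]. *)
have s_gt0 : 0 < 2 + b + c by rewrite -addrA ltr_wpDr ?addr_ge0.
have d_gt0 : 0 < e * (1 - a) / (2 + b + c).
  by rewrite divr_gt0 ?mulr_gt0 ?subr_gt0.
have small := reich_displacement_near x d_gt0.
near=> m n; rewrite ballEmdist/=.
have hm : mdist (iter m f x) (f (iter m f x)) < e * (1 - a) / (2 + b + c).
  by near: m.
have hn : mdist (iter n f x) (f (iter n f x)) < e * (1 - a) / (2 + b + c).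
  by near: n.
apply: (le_lt_trans (reich_mdist_le _ _)); rewrite ltr_pdivrMr ?subr_gt0//.
have -> : e * (1 - a) = (1 + b) * (e * (1 - a) / (2 + b + c)) +
    (1 + c) * (e * (1 - a) / (2 + b + c)) by field; exact: lt0r_neq0.
by rewrite ltrD// ltr_pM2l// ltr_pwDl.
Unshelve. all: by end_near. Qed.

(** As [f] may be discontinuous, [l] is compared with a late iterate [y] that is close to [l] and
    has small displacement. *)
Lemma reich_cvg_fixed x l : (fun n => iter n f x) @ \oo --> l -> f l = l.
Proof.
move=> x_l; apply/esym/mdist_positivity/eqP.
rewrite eq_le mdist_ge0 andbT leNgt; apply/negP => fl_gt0.
(* The path [l], [y], [f y], [f l] and the contraction give [(1 - c) * mdist l (f l) <= (1 + a) *
   mdist l y + (1 + b) * mdist y (f y)]. Both factors are at most 2, so the right side is below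
   [4 * e], a contradiction. *)
pose e := (1 - c) * mdist l (f l) / 4.
have e_gt0 : 0 < e by rewrite divr_gt0 ?mulr_gt0 ?subr_gt0.
have [n [dn ln]] : exists n, mdist (iter n f x) (f (iter n f x)) < e /\
    mdist l (iter n f x) < e.
  apply: (@filter_ex _ \oo); apply: filterI.
    exact: reich_displacement_near.
  exact: (metricType_numDomainType.cvgr_dist_lt x_l).
set y := iter n f x in dn ln.
have tri1 := metric_triangle l y (f l).
have tri2 := metric_triangle y (f y) (f l).
have fyl := f_reich y l; rewrite (metric_sym y l) in fyl.
have al : a * mdist l y <= mdist l y.
  by rewrite ler_piMl ?mdist_ge0// ltW.
have bd : b * mdist y (f y) <= mdist y (f y).
  by rewrite ler_piMl ?mdist_ge0.
by rewrite /e in dn ln; lra.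
Qed.

Lemma reich_fixed_unique x y : f x = x -> f y = y -> x = y.
Proof.
move=> fx fy; apply/mdist_positivity/eqP; rewrite eq_le mdist_ge0 andbT.
by have := reich_mdist_le x y; rewrite fx fy !mdistxx !mulr0 addr0 mul0r.
Qed.

Lemma reich_fixed_point (x0 : X)
    (X_complete : forall u : nat -> X,
       cauchy (u @ \oo) -> exists l : X, u @ \oo --> l) :
  exists xs, [/\ f xs = xs, forall y, f y = y -> y = xs &
    forall x, (fun n => iter n f x) @ \oo --> xs].
Proof.
have iter_cvg x := X_complete _ (reich_iter_cauchy x).
have [xs x0_xs] := iter_cvg x0; have fxs := reich_cvg_fixed x0_xs.
exists xs; split=> // [y fy|x]; first exact: reich_fixed_unique.
(* The limit of any other orbit is also a fixed point, hence equals [xs]. *)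
have [l x_l] := iter_cvg x.
by rewrite (reich_fixed_unique fxs (reich_cvg_fixed x_l)).
Qed.

End ReichContraction.

Theorem corollary3p6 (R : realType) (X : pointedType)
    (p : perturbed_metric R X) (p_complete : perturbed_complete p)
    (M : R) (M_ge1 : 1 <= M)
    (DM : forall x y : X, pdist p x y <= M * exact_dist p x y)
    (T : X -> X) (a b c : R) (a_ge0 : 0 <= a) (b_ge0 : 0 <= b) (c_ge0 : 0 <= c)
    (T_contr : forall x y : X, pdist p (T x) (T y) <=
       a * pdist p x y + b * pdist p x (T x) + c * pdist p y (T y))
    (Mabc : M * (a + b + c) < 1) :
  exists xs : X, [/\ T xs = xs,
    forall y : X, T y = y -> y = xs &
    forall x0 : X,
      ((fun n => iter n T x0) : nat -> exact_space p) @ \oo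
        --> (xs : exact_space p)].
Proof.
have D_ge x y : exact_dist p x y <= pdist p x y.
  by rewrite gerBl perturbation_ge0.
have M_ge0 : 0 <= M by lra.
have reich (x y : exact_space p) : mdist (T x : exact_space p) (T y) <=
    M * a * mdist x y + M * b * mdist x (T x) + M * c * mdist y (T y).
  apply: (le_trans (D_ge _ _)); apply: (le_trans (T_contr x y)).
  (* Regroup each [M * a * d] as [a * (M * d)], so that [DM] applies term by term. *)
  rewrite ![M * _]mulrC -!mulrA.
  by rewrite !lerD ?ler_wpM2l.
apply: (reich_fixed_point _ _ _ _ reich) => [||||| u /p_complete/cvg_ex//].
- by rewrite mulr_ge0.
- by rewrite mulr_ge0.
- by rewrite mulr_ge0.
- by rewrite -!mulrDr.
- exact: (point : X).
Qed.
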